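(* Let $G=(V,E)$ be a strongly connected digraph with $n$ vertices, $n>1$, let $\mathcal{G}$ be the set of cycles of $G$, and let $\mathcal{G}_1,\ldots,\mathcal{G}_p$ be the principal subsets of $\mathcal{G}$. Let $w\in\operatorname{Sp}(V)$. Then $$\mathbb{A}_G(w)=\bigcup_{i=1}^p\operatorname{Co}(\mathcal{G}_i).$$
   Context: Digraphs are finite and simple: no self-loops and at most one edge for each ordered pair of vertices; $V=\{1,\ldots,n\}$. $G$ is strongly connected if for every ordered pair $(i,j)$ of vertices there is a (directed) path from $i$ to $j$. $\operatorname{Sp}(V)$ is the set of vectors in $\mathbb{R}^n$ with all entries positive and summing to one. An infinitesimal stochastic matrix (ISM) is a real square matrix with non-negative off-diagonal entries whose rows each sum to zero. $\mathbb{A}_G$ is the set of $n\times n$ ISMs $A=(a_{ij})$ with $a_{ij}=0$ whenever $i\neq j$ and $i\to j$ is not an edge of $G$. $\mathbb{A}_G(w)$ is the set of $A\in\mathbb{A}_G$ having a simple zero eigenvalue and satisfying $A^\top w=0$. A cycle of $G$ is a subgraph of $G$ which is a directed cycle with at least two vertices; $\mathcal{G}=\{G_1,\ldots,G_k\}$ is the set of all cycles of $G$. For $w\in\operatorname{Sp}(V)$, the ISM $C_i$ associated with the cycle $G_i$ is the ISM whose $jk$-th entry ($j\ne k$) equals $1/w_j$ if $j\to k$ is an edge of $G_i$ and $0$ otherwise; its diagonal entries are set so that each row sums to zero. A subset $\{G'_1,\ldots,G'_m\}$ of $\mathcal{G}$, with $G'_i=(V'_i,E'_i)$, is principal if the graph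 $(V,\cup_iE'_i)$ is strongly connected. For a subset $\mathcal{G}'=\{G_{i_1},\ldots,G_{i_m}\}$ of $\mathcal{G}$, $\operatorname{Co}(\mathcal{G}')=\{\sum_{j=1}^m\alpha_jC_{i_j}\mid\alpha_j>0\}$. *)

(* Defs.v *)
From mathcomp Require Import all_boot all_order all_algebra.
From mathcomp Require Import boolp classical_sets reals.

Set Implicit Arguments.
Unset Strict Implicit.
Unset Printing Implicit Defensive.

Import Order.TTheory GRing.Theory Num.Theory.

Local Open Scope classical_set_scope.
Local Open Scope ring_scope.

(* A digraph on the vertex set 'I_n is given by its edge relation [E : rel 'I_n];
   simplicity is [irreflexive E].  Subgraphs have their own vertex set, so they
   are pairs (vertices, edges); being pairs of finite sets, they form a finType. *)
Notation subdigraph n := ({set 'I_n} * {set 'I_n * 'I_n})%type.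

Definition strongly_connected (n : nat) (E : rel 'I_n) : Prop :=
  forall i j : 'I_n, connect E i j.

(* [s] lists the vertices in cyclic order. *)
Definition directed_cycle (n : nat) (H : subdigraph n) : Prop :=
  exists s : seq 'I_n,
    [/\ uniq s, H.1 = [set x in s]%SET
      & H.2 = [set (x, next s x) | x in s]%SET].

Definition cycles (n : nat) (E : rel 'I_n) : set (subdigraph n) :=
  [set H : subdigraph n | [/\ directed_cycle H, (1 < #|H.1|)%N
             & forall i j, (i, j) \in H.2 -> E i j]].

Definition union_edges (n : nat) (S : {set subdigraph n}) : rel 'I_n :=
  [rel i j | [exists H in S, (i, j) \in H.2]].

Definition principal (n : nat) (E : rel 'I_n) : set {set subdigraph n} :=
  [set S : {set subdigraph n} | (forall H, H \in S -> cycles E H)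
           /\ strongly_connected (union_edges S)].

Definition Sp (R : realType) (n : nat) : set 'cV[R]_n :=
  [set w : 'cV[R]_n | (forall i, 0 < w i 0) /\ \sum_i w i 0 = 1].

Definition ISM (R : realType) (n : nat) : set 'M[R]_n :=
  [set A : 'M[R]_n | (forall i j, i != j -> 0 <= A i j)
           /\ (forall i, \sum_j A i j = 0)].

Definition ISM_of (R : realType) (n : nat) (E : rel 'I_n) : set 'M[R]_n :=
  [set A : 'M[R]_n | ISM A /\ (forall i j, i != j -> ~~ E i j -> A i j = 0)].

(* "Simple" refers to algebraic multiplicity. *)
Definition simple_zero_eigenvalue (R : realType) (n : nat) (A : 'M[R]_n) :
  Prop := mup 0 (char_poly A) = 1%N.

Definition ISM_of_at (R : realType) (n : nat) (E : rel 'I_n) (w : 'cV[R]_n) :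
    set 'M[R]_n :=
  [set A : 'M[R]_n | [/\ ISM_of E A, simple_zero_eigenvalue A & A^T *m w = 0]].

Definition cycle_rate (R : realType) (n : nat) (w : 'cV[R]_n)
    (H : subdigraph n) (j k : 'I_n) : R :=
  if (j, k) \in H.2 then (w j 0)^-1 else 0.

Definition cycle_ISM (R : realType) (n : nat) (w : 'cV[R]_n)
    (H : subdigraph n) : 'M[R]_n :=
  \matrix_(j, k) if j == k then - \sum_(l | l != j) cycle_rate w H j l
                 else cycle_rate w H j k.

Definition Co (R : realType) (n : nat) (w : 'cV[R]_n)
    (S : {set subdigraph n}) : set 'M[R]_n :=
  [set A : 'M[R]_n | exists alpha : subdigraph n -> R,
     (forall H, H \in S -> 0 < alpha H)
     /\ A = \sum_(H in S) alpha H *: cycle_ISM w H].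

(* Main.v *)
(* Work with the flow [f i j = w_i a_ij] on edges: [A^T w = 0] says that it is
   balanced at every vertex, so it has no net flux through any cut.  A balanced
   nonnegative flow therefore has, along with each edge [i -> j], a path back
   from [j] to [i]; peeling off cycles one by one decomposes it as a nonnegative
   combination of cycle flows, whose edges together form its support.

   The zero eigenvalue of [A] is simple iff the support is strongly connected.
   With [u] the all-ones vector, [w^T u = 1] and [A u = 0] give
   [X * chi(A + u w^T) = (X - 1) * chi(A)], so simplicity amounts to
   [A + u w^T] being invertible, i.e. to the left kernel of [A] meeting the
   vectors of zero sum trivially.  If the support is strongly connected, the
   maximum principle applied to [v_i / w_i] shows that left null vectors [v] are
   multiples of [w]; otherwise, a set [S] closed under successors is also closed
   under predecessors, and [w] restricted to [S] is a second null vector. *)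
Require Import Defs.
From mathcomp Require Import all_boot all_order all_algebra.
From mathcomp Require Import boolp classical_sets reals.
From mathcomp Require Import ring.

Import Order.TTheory GRing.Theory Num.Theory.

Local Open Scope classical_set_scope.
Local Open Scope ring_scope.

Set Implicit Arguments.
Unset Strict Implicit.
Unset Printing Implicit Defensive.

(** * Balanced flows, cuts and the cycles in their support *)

Definition balanced (R : nmodType) (T : finType) (f : T -> T -> R) : Prop :=
  forall i, \sum_j f i j = \sum_j f j i.

Definition support_rel (R : nmodType) (T : finType) (f : T -> T -> R) : rel T :=
  [rel i j | f i j != 0].

Section Flows.

Variables (R : realFieldType) (T : finType).
Implicit Type f : T -> T -> R.

(** Summing the balance equations over [S], the flow inside [S] cancels, so total inflow equals
    total outflow, which is zero; being a sum of nonnegative terms, the inflow vanishes term by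
    term. *)
Lemma balanced_no_inflow f (S : {set T}) :
    (forall i j, 0 <= f i j) -> balanced f ->
    (forall i j, i \in S -> j \notin S -> f i j = 0) ->
  forall i j, i \notin S -> j \in S -> f i j = 0.
Proof.
move=> f_ge0 f_bal no_out i j iNS jS.
have inflow0 : \sum_(k in S) \sum_(l | l \notin S) f l k = 0.
  have : \sum_(k in S) \sum_l f k l = \sum_(k in S) \sum_l f l k.
    by apply: eq_bigr.
  under eq_bigr do rewrite (bigID (mem S)) /=.
  under [RHS]eq_bigr do rewrite (bigID (mem S)) /=.
  rewrite !big_split /= [X in X + _ = _]exchange_big /= => /addrI <-.
  by apply: big1 => k kS; apply: big1 => l lNS; exact: no_out.
have sum_ge0 k : k \in S -> 0 <= \sum_(l | l \notin S) f l k.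
  by move=> _; apply: sumr_ge0.
by apply: (psumr_eq0P _ (psumr_eq0P sum_ge0 inflow0 jS)).
Qed.

(** No flow leaves the set of vertices reachable from [j], hence none enters it; if [i] lay outside,
    the edge from [i] to [j] would carry nothing. *)
Lemma balanced_connect_sym f i j :
    (forall i j, 0 <= f i j) -> balanced f ->
  f i j != 0 -> connect (support_rel f) j i.
Proof.
move=> f_ge0 f_bal fij; apply: contraNT fij => Nji.
pose S := [set k | connect (support_rel f) j k]%SET.
apply/eqP/(@balanced_no_inflow f S) => //; rewrite ?inE ?connect0 // => k l.
rewrite !inE => jk; apply: contraNeq => fkl.
exact: connect_trans jk (connect1 fkl).
Qed.

Lemma balanced_support_cycle f i j :
    (forall i j, 0 <= f i j) -> balanced f -> f i j != 0 -> i != j ->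
  exists s : seq T, [/\ uniq s, (1 < size s)%N & cycle (support_rel f) s].
Proof.
move=> f_ge0 f_bal fij ij.
have /connectP[p jp lastp] := balanced_connect_sym f_ge0 f_bal fij.
case/shortenP: jp lastp => q jq uq _ lastq; exists (j :: q); split=> //.
  (* An empty [q] would mean [i = j], so the cycle has at least two vertices. *)
  by case: q {jq uq} lastq ij => //= ->; rewrite eqxx.
by rewrite /= rcons_path jq -lastq.
Qed.

End Flows.

(** * Decomposition of a balanced flow into cycles *)

Definition cycle_of (n : nat) (s : seq 'I_n) : subdigraph n :=
  ([set x in s]%SET, [set (x, next s x) | x in s]%SET).

Lemma mem_edges_cycle_of (n : nat) (s : seq 'I_n) i j :
  ((i, j) \in (cycle_of s).2) = (i \in s) && (j == next s i).
Proof.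
apply/imsetP/andP => [[x xs [-> ->]]|[i_s /eqP ->]]; first by rewrite eqxx.
by exists i.
Qed.

(** A vertex of the cycle has exactly one outgoing edge, to its [next], and one incoming edge, from
    its [prev]; other vertices have neither. *)
Lemma balanced_directed_cycle (R : nzSemiRingType) (n : nat)
    (H : subdigraph n) :
  directed_cycle H -> balanced (fun i j => ((i, j) \in H.2)%:R : R).
Proof.
case: H => V F [s [us /= _ ->]] i; rewrite -/(cycle_of s).2.
under eq_bigr do rewrite mem_edges_cycle_of mulrb.
under [RHS]eq_bigr do rewrite mem_edges_cycle_of mulrb.
case: (boolP (i \in s)) => i_s /=; last first.
  rewrite !big1 // => j _; case: andP => // -[j_s /eqP ij].
  by rewrite ij mem_next j_s in i_s.
rewrite -big_mkcond big_pred1_eq -big_mkcond (big_pred1 (prev s i)) // => j.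
apply/andP/eqP => [[_ /eqP ->]|->]; first by rewrite prev_next.
by rewrite mem_prev next_prev.
Qed.

(** Induction on the size of the support: subtracting from a cycle in the support the least flow
    along it keeps the flow nonnegative and balanced, and removes at least one edge. *)
Lemma balanced_cycle_decomposition (R : realFieldType) (n : nat)
    (f : 'I_n -> 'I_n -> R) :
    (forall i j, 0 <= f i j) -> (forall i, f i i = 0) -> balanced f ->
  exists alpha : subdigraph n -> R,
    [/\ forall H, 0 <= alpha H,
        forall H, alpha H != 0 -> directed_cycle H /\ (1 < #|H.1|)%N
      & forall i j, f i j = \sum_H alpha H * ((i, j) \in H.2)%:R].
Proof.
have [m] := ubnP #|[set p | f p.1 p.2 != 0]%SET|.
elim: m f => // m IHm f supp_lt f_ge0 f_diag f_bal.
have [f0|] := pselect (forall i j, f i j = 0).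
  exists (fun=> 0); split=> // [H|i j]; first by rewrite eqxx.
  by rewrite f0 big1 // => H _; rewrite mul0r.
move/existsNP => [a] /existsNP [b] /eqP fab.
have ab : a != b by apply: contraNneq fab => ->; rewrite f_diag.
have [s [us s_gt1 cyc_s]] := balanced_support_cycle f_ge0 f_bal fab ab.
have [x0 x0s] : exists x, x \in s.
  by case: s s_gt1 {us cyc_s} => // x s _; exists x; rewrite mem_head.
have [x] := @arg_minP _ _ _ x0 (mem s) (fun x => f x (next s x)) x0s.
move=> /(fun xs => xs : x \in s) xs x_min.
set c := f x (next s x) in x_min.
have f_next y : y \in s -> f y (next s y) != 0 := next_cycle cyc_s.
have c_gt0 : 0 < c by rewrite lt_def f_ge0 andbT f_next.
pose H := cycle_of s.
pose g i j := f i j - c * ((i, j) \in H.2)%:R.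
have Hcyc : directed_cycle H by exists s.
have supp_g i j : g i j != 0 -> f i j != 0.
  rewrite /g mem_edges_cycle_of; case: andP => [[i_s /eqP ->] _|_].
    exact: f_next.
  by rewrite mulr0 subr0.
have [||||alpha [al_ge0 al_cyc g_al]] := IHm g.
- rewrite -ltnS (leq_trans _ supp_lt) // ltnS proper_card //.
  apply/properP; split.
    by apply/fintype.subsetP => -[i j]; rewrite !inE /=; apply: supp_g.
  (* The edge attaining the minimum [c] leaves the support. *)
  exists (x, next s x); rewrite !inE /= ?f_next //.
  by rewrite negbK /g mem_edges_cycle_of xs eqxx mulr1 subrr.
- move=> i j; rewrite /g mem_edges_cycle_of.
  case: andP => [[i_s /eqP ->]|_]; last by rewrite mulr0 subr0.
  by rewrite mulr1 subr_ge0 x_min.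
- move=> i; apply: contraTeq isT => /[dup] /supp_g.
  by rewrite f_diag eqxx.
- move=> i; rewrite !sumrB -!mulr_sumr f_bal.
  by rewrite (balanced_directed_cycle R Hcyc).
exists (fun K => alpha K + c * (K == H)%:R); split.
- by move=> K; rewrite addr_ge0 ?al_ge0 // mulr_ge0 // ltW.
- move=> K; have [->|_] := eqVneq K H; last by rewrite mulr0 addr0 => /al_cyc.
  by split=> //=; rewrite cardsE (card_uniqP us).
move=> i j; under eq_bigr do rewrite mulrDl.
rewrite big_split /= -g_al (bigD1 H) //= big1 => [|K /negPf ->].
  by rewrite eqxx mulr1 addr0 subrK.
by rewrite mulr0 mul0r.
Qed.

(** * Simplicity of the zero eigenvalue through a rank-one perturbation *)

Lemma char_poly_rank1_perturbation (F : comNzRingType) (n : nat) (A : 'M[F]_n)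
    (u : 'cV[F]_n) (v : 'rV[F]_n) :
    A *m u = 0 -> v *m u = 1%:M ->
  'X * char_poly (A + u *m v) = ('X - 1) * char_poly A.
Proof.
move=> Au0 vu1; pose up := map_mx polyC u; pose vp := map_mx polyC v.
(* The determinant of this bordered matrix is computed twice: clearing [vp] leaves the Schur
   complement [X - A - u v], while clearing [up] uses [A u = 0] and [v u = 1]. *)
pose M : 'M[{poly F}]_(1 + n) := block_mx 1%:M vp up (char_poly_mx A).
have detM : \det M = char_poly (A + u *m v).
  have M_eq : M *m block_mx 1%:M (- vp) 0 1%:M =
      block_mx 1%:M 0 up (char_poly_mx (A + u *m v)).
    rewrite mulmx_block !mulmx1 !mulmx0 !mul1mx !addr0 addNr mulmxN.
    by rewrite /char_poly_mx map_mxD map_mxM opprD addrC addrA.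
  have := congr1 determinant M_eq.
  by rewrite det_mulmx det_ublock det_lblock !det1 !mulr1 mul1r.
have M_eq : M *m block_mx 'X%:M 0 (- up) 1%:M =
    block_mx ('X - 1)%:M vp 0 (char_poly_mx A).
  rewrite mulmx_block !mulmx1 !mulmx0 !mul1mx !add0r !mulmxN -map_mxM vu1.
  rewrite map_scalar_mx /= raddfB /= mul_mx_scalar mulmxBl -map_mxM Au0.
  by rewrite map_mx0 subr0 mul_scalar_mx subrr.
have := congr1 determinant M_eq.
by rewrite det_mulmx det_ublock det_lblock !det_scalar1 det1 mulr1 detM mulrC.
Qed.

Lemma simple_zero_eigenvalueP (R : realType) (n : nat) (A : 'M[R]_n)
    (w : 'cV[R]_n) (u := const_mx 1 : 'cV[R]_n) :
    A *m u = 0 -> w^T *m u = 1%:M ->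
  simple_zero_eigenvalue A <->
  (forall v : 'rV[R]_n, v *m A = 0 -> v *m u = 0 -> v = 0).
Proof.
move=> Au0 wu1; pose B := A + u *m w^T.
have charB := char_poly_rank1_perturbation Au0 wu1.
have -> : simple_zero_eigenvalue A <-> ~~ eigenvalue B 0.
  rewrite /simple_zero_eigenvalue eigenvalue_root_char.
  have Bn0 := monic_neq0 (char_poly_monic B).
  (* Since ['X - 1] does not vanish at 0, the factor ['X] alone shifts the multiplicity, by one. *)
  have mupA : mup 0 (char_poly A) = (mup 0 (char_poly B)).+1.
    have X1 : ~~ root ('X - 1 : {poly R}) 0.
      by rewrite rootE !hornerE oppr_eq0 oner_eq0.
    rewrite -(mupMr (char_poly A) X1).
    rewrite -charB mupM ?polyX_eq0 //.
    by have := mup_XsubCX 1 (0 : R) 0; rewrite eqxx subr0 expr1 => ->.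
  rewrite mupA; split=> [[mB]|/mupNroot -> //].
  by rewrite -dvdp_XsubCl XsubC_dvd // mB.
split=> [noB v vA vu|noA].
  apply: contraNeq noB => v0; apply/eigenvalueP; exists v => //.
  by rewrite mulmxDr vA mulmxA vu mul0mx addr0 scale0r.
apply/negP => /eigenvalueP[v vB /negP[]]; rewrite scale0r in vB.
(* Multiply [v B = 0] on the right by [u]: what remains is [v u], as [A u = 0] and [w^T u = 1]. *)
have vu : v *m u = 0.
  have := congr1 (mulmx^~ u) vB.
  by rewrite mul0mx mulmxDr mulmxDl -!mulmxA Au0 wu1 mulmx0 add0r mulmx1.
rewrite (noA v) //.
by move: vB; rewrite mulmxDr mulmxA vu mul0mx addr0.
Qed.

(** * The flow of an ISM, and simplicity as strong connectedness of its support *)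

Definition edge_flow (R : pzSemiRingType) (n : nat) (w : 'cV[R]_n)
    (A : 'M[R]_n) (i j : 'I_n) : R :=
  if i == j then 0 else w i 0 * A i j.

Lemma edge_flow_ge0 (R : realType) (n : nat) (w : 'cV[R]_n) (A : 'M[R]_n) i j :
  Sp w -> ISM A -> 0 <= edge_flow w A i j.
Proof.
move=> [w_gt0 _] [A_ge0 _]; rewrite /edge_flow.
by case: eqVneq => // ij; rewrite mulr_ge0 ?A_ge0 // ltW.
Qed.

Lemma trmx_mulmx_eq0P (R : comPzRingType) (n : nat) (w : 'cV[R]_n)
    (A : 'M[R]_n) :
  A^T *m w = 0 <-> forall j, \sum_i w i 0 * A i j = 0.
Proof.
have AwE j : (A^T *m w) j 0 = \sum_i w i 0 * A i j.
  by rewrite mxE; apply: eq_bigr => i _; rewrite mxE mulrC.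
split=> [Aw0 j|Aw0]; first by rewrite -AwE Aw0 mxE.
by apply/matrixP => j k; rewrite ord1 AwE mxE.
Qed.

(** Off the diagonal, the outflow at [i] is [- w_i a_ii] because the row sums to zero, and the
    inflow is the column sum [(A^T w)_i] minus [w_i a_ii]; they agree exactly when that column sum
    vanishes. *)
Lemma balanced_edge_flow (R : comPzRingType) (n : nat) (w : 'cV[R]_n)
    (A : 'M[R]_n) :
    (forall i, \sum_j A i j = 0) ->
  balanced (edge_flow w A) <-> A^T *m w = 0.
Proof.
move=> A_row0; rewrite trmx_mulmx_eq0P.
have outE i : \sum_j edge_flow w A i j = - (w i 0 * A i i).
  have := congr1 ( *%R (w i 0)) (A_row0 i); rewrite mulr0 mulr_sumr.
  rewrite (bigD1 i) //= (bigD1 (F := edge_flow w A i) i) //=.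
  rewrite {1}/edge_flow eqxx add0r addrC => /eqP; rewrite addr_eq0 => /eqP <-.
  by apply: eq_bigr => j; rewrite /edge_flow eq_sym => /negPf ->.
have inE i : \sum_j edge_flow w A j i = \sum_j w j 0 * A j i - w i 0 * A i i.
  rewrite (bigD1 i) //= [in RHS](bigD1 i) //= {1}/edge_flow eqxx.
  rewrite add0r addrAC subrr add0r.
  by apply: eq_bigr => j; rewrite /edge_flow => /negPf ->.
split=> [bal j|Aw0 i].
  have := bal j; rewrite outE inE => /esym.
  by rewrite -[RHS]add0r => /addIr.
by rewrite outE inE Aw0 add0r.
Qed.

Lemma simple_zero_strongly_connected (R : realType) (n : nat) (w : 'cV[R]_n)
    (A : 'M[R]_n) :
    Sp w -> ISM A -> A^T *m w = 0 ->
  simple_zero_eigenvalue A <-> strongly_connected (support_rel (edge_flow w A)).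
Proof.
move=> w_Sp A_ISM Aw0; have [w_gt0 w_sum1] := w_Sp.
have [_ A_row0] := A_ISM.
pose u : 'cV[R]_n := const_mx 1.
have mul_u (v : 'rV[R]_n) : v *m u = (\sum_i v 0 i)%:M.
  apply/matrixP => i j; rewrite !ord1 !mxE; apply: eq_bigr => k _.
  by rewrite mxE mulr1.
rewrite (@simple_zero_eigenvalueP _ _ _ w); first last.
- by rewrite mul_u; under eq_bigr do rewrite mxE; rewrite w_sum1.
- apply/matrixP => i j; rewrite !mxE -[RHS](A_row0 i).
  by apply: eq_bigr => k _; rewrite mxE mulr1.
have f_ge0 i j : 0 <= edge_flow w A i j := edge_flow_ge0 i j w_Sp A_ISM.
have f_bal := (balanced_edge_flow w A_row0).2 Aw0.
have Aw0' := (trmx_mulmx_eq0P w A).1 Aw0.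
split=> [no_ker|connA].
  move=> a b; apply: contrapT => /negP Nab.
  pose S := [set i | connect (support_rel (edge_flow w A)) a i]%SET.
  have no_out i j : i \in S -> j \notin S -> edge_flow w A i j = 0.
    rewrite !inE => ai; apply: contraNeq => fij.
    exact: connect_trans ai (connect1 fij).
  have no_in := balanced_no_inflow f_ge0 f_bal no_out.
  have cut0 i j : (i \in S) != (j \in S) -> w i 0 * A i j = 0.
    move=> ij_cut; have : edge_flow w A i j = 0.
      have [iS|iNS] := boolP (i \in S); have [jS|jNS] := boolP (j \in S).
      - by rewrite iS jS in ij_cut.
      - exact: no_out.
      - exact: no_in.
      - by rewrite (negPf iNS) (negPf jNS) in ij_cut.
    by rewrite /edge_flow; have [ij|//] := eqVneq i j; rewrite ij eqxx in ij_cut.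
  have S_col0 j : \sum_(i in S) w i 0 * A i j = 0.
    have [jS|jNS] := boolP (j \in S).
      have := Aw0' j; rewrite (bigID (mem S)) /= [X in _ + X]big1 ?addr0 //.
      by move=> i iNS; apply: cut0; rewrite jS (negPf iNS).
    by rewrite big1 // => i iS; apply: cut0; rewrite iS (negPf jNS).
  pose c := \sum_(i in S) w i 0.
  (* The restriction of [w] to [S], corrected by the multiple [c] of [w] that makes its sum zero,
     since [w] sums to one. *)
  pose v : 'rV[R]_n := \row_i (w i 0 * ((i \in S)%:R - c)).
  have v0 : v = 0.
    apply: no_ker.
      apply/rowP => j; rewrite !mxE.
      have vE i : v 0 i * A i j =
          w i 0 * A i j * (i \in S)%:R - c * (w i 0 * A i j).
        by rewrite mxE; ring.
      under eq_bigr do rewrite vE.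
      rewrite sumrB -mulr_sumr Aw0' mulr0 subr0 -[RHS](S_col0 j) [RHS]big_mkcond.
      by apply: eq_bigr => i _; case: (i \in S); rewrite ?mulr1 ?mulr0.
    rewrite mul_u; under eq_bigr do rewrite mxE mulrBr.
    rewrite sumrB -mulr_suml w_sum1 mul1r /c [X in _ - X]big_mkcond -sumrB.
    rewrite big1 ?raddf0 //.
    by move=> i _; case: (i \in S); rewrite ?mulr1 ?mulr0 subrr.
  (* The indicator of [S] would be constant, yet [a] is in [S] and [b] is not. *)
  have Sc i : (i \in S)%:R = c.
    have /eqP := congr1 (fun v : 'rV[R]_n => v 0 i) v0; rewrite !mxE.
    by rewrite mulf_eq0 (gt_eqF (w_gt0 i)) subr_eq0 => /eqP.
  have := Sc a; rewrite -(Sc b) !inE connect0 (negPf Nab) => /eqP.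
  by rewrite oner_eq0.
move=> v /rowP vA0 vu0; apply/rowP => i0.
pose x i := v 0 i / w i 0.
have vE i : v 0 i = w i 0 * x i by rewrite mulrC divfK // gt_eqF.
have [k _ x_max] := @arg_maxP _ _ _ i0 predT x isT.
(* Maximum principle: if [j] attains the maximum, column [j] gives a vanishing sum of nonnegative
   terms, so every predecessor attains it too. The diagonal entry, possibly negative, is multiplied
   by [x k - x j = 0]. *)
have x_pred i j : edge_flow w A i j != 0 -> x j = x k -> x i = x k.
  rewrite /edge_flow; have [_|ij] := eqVneq i j; first by rewrite eqxx.
  move=> wA_neq0 xj.
  have term_ge0 l : true -> 0 <= (x k - x l) * (w l 0 * A l j).
    move=> _; have [->|lj] := eqVneq l j; first by rewrite xj subrr mul0r.
    apply: mulr_ge0; first by rewrite subr_ge0; exact: x_max.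
    by apply: mulr_ge0; [exact: ltW | exact: A_ISM.1].
  have sum0 : \sum_l (x k - x l) * (w l 0 * A l j) = 0.
    under eq_bigr do rewrite mulrBl.
    rewrite sumrB -mulr_sumr Aw0' mulr0 sub0r; apply/eqP; rewrite oppr_eq0.
    have := vA0 j; rewrite !mxE => vAj; apply/eqP; rewrite -[RHS]vAj.
    by apply: eq_bigr => l _; rewrite vE mulrCA mulrA.
  have /eqP := psumr_eq0P term_ge0 sum0 (i := i) isT.
  by rewrite mulf_eq0 (negPf wA_neq0) orbF subr_eq0 => /eqP.
have x_const i : x i = x k.
  have /connectP[p ip kp] := connA i k.
  elim: p i ip kp => [|j p IHp] i /= => [_ ->//|/andP[fij jp] kp].
  exact: x_pred fij (IHp j jp kp).
have : \sum_i v 0 i = 0.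
  by have /matrixP/(_ 0 0) := vu0; rewrite mul_u !mxE mulr1n.
under eq_bigr do rewrite vE x_const.
by rewrite -mulr_suml w_sum1 mul1r mxE vE x_const => ->; rewrite mulr0.
Qed.

(** * The cones [Co] in terms of flows, and the two inclusions *)

Lemma CoP (R : realType) (n : nat) (w : 'cV[R]_n) (S : {set subdigraph n})
    (A : 'M[R]_n) :
    Sp w ->
  Co w S A <-> exists alpha : subdigraph n -> R,
    [/\ forall H, H \in S -> 0 < alpha H, forall i, \sum_j A i j = 0
      & forall i j, i != j ->
          w i 0 * A i j = \sum_(H in S) alpha H * ((i, j) \in H.2)%:R].
Proof.
move=> [w_gt0 _].
have C_row0 H i : \sum_j cycle_ISM w H i j = 0.
  rewrite (bigD1 i) //= mxE eqxx addrC.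
  under eq_bigr => j ij do rewrite mxE eq_sym (negPf ij).
  exact: subrr.
have CE H i j : i != j -> w i 0 * cycle_ISM w H i j = ((i, j) \in H.2)%:R.
  move=> /negPf ij; rewrite mxE ij /cycle_rate.
  by case: ifP => _; rewrite ?mulr0 // divff // gt_eqF.
pose B alpha := \sum_(H in S) alpha H *: cycle_ISM w H : 'M[R]_n.
have B_row0 alpha i : \sum_j B alpha i j = 0.
  under eq_bigr do rewrite summxE; rewrite exchange_big /= big1 // => H _.
  by under eq_bigr do rewrite mxE; rewrite -mulr_sumr C_row0 mulr0.
have BE alpha i j : i != j ->
    w i 0 * B alpha i j = \sum_(H in S) alpha H * ((i, j) \in H.2)%:R.
  move=> ij; rewrite summxE mulr_sumr; apply: eq_bigr => H _.
  by rewrite mxE mulrCA CE.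
split=> [[alpha [al_gt0 ->]]|[alpha [al_gt0 A_row0 AE]]].
  by exists alpha; split=> //; [exact: B_row0|exact: BE].
exists alpha; split=> //; rewrite -/(B alpha).
have AB i j : i != j -> A i j = B alpha i j.
  by move=> ij; apply: (mulfI (lt0r_neq0 (w_gt0 i))); rewrite AE // BE.
(* Zero row sums determine the diagonal from the off-diagonal entries. *)
apply/matrixP => i j; have [<-{j}|/AB //] := eqVneq i j.
have := A_row0 i; rewrite -[RHS](B_row0 alpha i) (bigD1 i) //=.
rewrite [RHS](bigD1 i) //= (eq_bigr (B alpha i)); first exact: addIr.
by move=> j; rewrite eq_sym => /AB.
Qed.

(** With positive weights nothing cancels: the sum is nonzero as soon as one cycle contains the
    edge. *)
Lemma support_rel_union_edges (R : realFieldType) (n : nat)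
    (S : {set subdigraph n}) (alpha : subdigraph n -> R)
    (f : 'I_n -> 'I_n -> R) :
    (forall H, H \in S -> 0 < alpha H) ->
    (forall i j, f i j = \sum_(H in S) alpha H * ((i, j) \in H.2)%:R) ->
  support_rel f =2 union_edges S.
Proof.
move=> al_gt0 fE i j; rewrite /support_rel /union_edges /= fE psumr_neq0; last first.
  by move=> H HS; rewrite mulr_ge0 // ltW ?al_gt0.
apply/hasP/existsP => [[H _ /andP[HS]]|[H /andP[HS ijH]]].
  by rewrite pmulr_rgt0 ?al_gt0 // ltr0n lt0b => ijH; exists H; rewrite HS.
by exists H; rewrite ?mem_index_enum // HS ijH mulr1 al_gt0.
Qed.

Unset Implicit Arguments.

Theorem proposition10 (R : realType) (n : nat) (E : rel 'I_n)
  (n_gt1 : (1 < n)%N)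
  (E_simple : irreflexive E)
  (E_connected : strongly_connected E)
  (w : 'cV[R]_n)
  (w_Sp : Sp w) :
  ISM_of_at E w = \bigcup_(S in principal E) Co w S.
Proof.
have w_gt0 := w_Sp.1.
rewrite eqEsubset; split=> [A [[A_ISM A_E] A_simple Aw0]|A].
  have [A_ge0 A_row0] := A_ISM.
  have f_ge0 i j : 0 <= edge_flow w A i j := edge_flow_ge0 i j w_Sp A_ISM.
  have f_diag i : edge_flow w A i i = 0 by rewrite /edge_flow eqxx.
  have [alpha [al_ge0 al_cyc f_al]] := balanced_cycle_decomposition f_ge0
    f_diag ((balanced_edge_flow w A_row0).2 Aw0).
  (* Dropping the cycles of weight zero leaves the strictly positive coefficients that [Co]
     demands. *)
  pose S := [set H | alpha H != 0]%SET.
  have al_gt0 H : H \in S -> 0 < alpha H by rewrite inE lt_def al_ge0 andbT.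
  have f_S i j :
      edge_flow w A i j = \sum_(H in S) alpha H * ((i, j) \in H.2)%:R.
    rewrite f_al [RHS]big_mkcond; apply: eq_bigr => H _; rewrite inE.
    by case: eqP => // ->; rewrite mul0r.
  have supp := support_rel_union_edges al_gt0 f_S.
  exists S; last first.
    apply/CoP => //; exists alpha; split=> // i j /negPf ij.
    by rewrite -f_S /edge_flow ij.
  split=> [H HS|i j].
    have [Hcyc H_gt1] : directed_cycle H /\ (1 < #|H.1|)%N.
      by apply: al_cyc; rewrite inE in HS.
    split=> // i j ijH.
    have : union_edges S i j by apply/existsP; exists H; rewrite HS.
    rewrite -supp /support_rel /edge_flow /=; have [_|ij] := eqVneq i j; first by rewrite eqxx.
    by apply: contraR => /(A_E _ _ ij) ->; rewrite mulr0.
  rewrite -(eq_connect supp).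
  exact: (simple_zero_strongly_connected w_Sp A_ISM Aw0).1.
move=> [S [S_cyc S_conn] /(CoP _ _ w_Sp)[alpha [al_gt0 A_row0 AE]]].
have f_S i j : edge_flow w A i j = \sum_(H in S) alpha H * ((i, j) \in H.2)%:R.
  rewrite /edge_flow; case: eqVneq => [<-|/AE //].
  (* On the diagonal every term vanishes, since cycles use only edges of [E], which has no loops. *)
  rewrite big1 // => H /S_cyc[_ _ H_E].
  case: (boolP (_ \in _)) => [/H_E|_]; last by rewrite mulr0.
  by rewrite E_simple.
have supp := support_rel_union_edges al_gt0 f_S.
have A_ISM : ISM A.
  split=> // i j ij; rewrite -(pmulr_rge0 _ (w_gt0 i)) AE //.
  by apply: sumr_ge0 => H HS; rewrite mulr_ge0 // ltW ?al_gt0.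
have Aw0 : A^T *m w = 0.
  apply/balanced_edge_flow => // i.
  under eq_bigr do rewrite f_S; under [RHS]eq_bigr do rewrite f_S.
  rewrite exchange_big [RHS]exchange_big /=; apply: eq_bigr => H /S_cyc[Hcyc _ _].
  by rewrite -!mulr_sumr (balanced_directed_cycle R Hcyc).
split=> //.
  split=> // i j ij NEij; apply: (mulfI (lt0r_neq0 (w_gt0 i))); rewrite AE //.
  rewrite mulr0 big1 // => H /S_cyc[_ _ H_E].
  case: (boolP (_ \in _)) => [/H_E Eij|_]; last by rewrite mulr0.
  by rewrite Eij in NEij.
apply/(simple_zero_strongly_connected w_Sp A_ISM Aw0) => i j.
by rewrite (eq_connect supp).
Qed.
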